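(* Let $G$ be a $\sigma$-compact locally compact abelian group which is an Archimedean ordered group, let $G_+=\{x\in G: x\ge 0\}$, and let $1\le p<\infty$. For $\mu\in M(G_+)$ define $T_\mu:J^p(G_+)\to J^p(G_+)$ by $T_\mu f=f\ast\mu$. Then $$\|T_\mu\|\ge |\hat\mu|_{\widehat G}=\sup_{\gamma\in\widehat G}|\hat\mu(\gamma)|,$$ where $\hat\mu$ is the Fourier-Stieltjes transform of $\mu$ and $\|T_\mu\|$ is the operator norm.
   Context: $G$ is written additively with identity $0$, Haar measure $m$ and dual group $\widehat G$ (continuous homomorphisms $G\to\mathbb T$, with $\langle x,\gamma\rangle$ denoting $\gamma(x)$). Ordered group: there is a closed semigroup $P\subset G$ with $P\cap(-P)=\{0\}$ and $P\cup(-P)=G$, and $x\ge y$ means $x-y\in P$; so $G_+=P$ and $G_-=\{x\in G:x\le 0\}=-P$. The order is Archimedean if for all $x,y>0$ there is a positive integer $n$ with $nx>y$. $M(G)$ is the algebra of complex valued regular Borel measures on $G$; $M(G_+)$ consists of those concentrated on $G_+$. The Fourier-Stieltjes transform is $\hat\mu(\gamma)=\int_G\langle -x,\gamma\rangle\,\mathrm d\mu(x)$, and $(f\ast\mu)(x)=\int_G f(x-y)\,\mathrm d\mu(y)$. $L^1_{loc}(G)$ is the space of complex valued measurable functions on $G$ (modulo a.e. equality) that are integrable on every compact set. For a compact neighbourhood $K\subset G$ (a compact set with nonempty interior), $J^p_K(G)$ is the space of $f\in L^1_{loc}(G)$ such that $$\|f\|_K=\sup_{x\in G}\left(\int_K|f(x-y)|^p\,\mathrm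 dm(y)\right)^{1/p}<\infty .$$ Different $K$ give the same space with equivalent norms, so one writes $J^p(G)$, with norm $\|\cdot\|=\|\cdot\|_K$ for a fixed compact neighbourhood $K$. $J^p(G_+)$ is the closed subspace of $J^p(G)$ consisting of all $f$ with $f(x)=0$ for almost all $x\in G_-\setminus\{0\}$, with the same norm. *)

(* Defs.v *)
From HB Require Import structures.
From mathcomp Require Import all_boot all_order all_algebra.
From mathcomp Require Import complex.
From mathcomp Require Import all_classical all_reals all_analysis.

Set Implicit Arguments.
Unset Strict Implicit.
Unset Printing Implicit Defensive.

Import Order.TTheory GRing.Theory Num.Theory numFieldNormedType.Exports.
Import Normc.

Local Open Scope classical_set_scope.
Local Open Scope ring_scope.

(* [borel G] is a copy of [G] carrying its Borel sigma-algebra; it is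
   pointed by 0 because measurable types have to be pointed. *)
Definition borel (G : topologicalZmodType) : Type := G.

Section borel_instances.
Variable G : topologicalZmodType.

HB.instance Definition _ := TopologicalZmodule.on (borel G).
HB.instance Definition _ := isPointed.Build (borel G) (0 : G).

Let borelC (A : set (borel G)) : <<s @open G >> A -> <<s @open G >> (~` A).
Proof. by move=> sA; rewrite -setTD; exact: sigma_algebraCD. Qed.

HB.instance Definition _ := @isMeasurable.Build (sigma_display (@open G))
  (borel G) <<s @open G >> (@sigma_algebra0 _ setT _) borelC
  (@sigma_algebra_bigcup _ setT _).

End borel_instances.

Section groups.
Context (R : realType) (G : topologicalZmodType).

Definition sigma_compact :=
  exists2 F : (set G)^nat, (forall n, compact (F n)) & \bigcup_n F n = setT.

(* [R[i]^o] is [R[i]] with the topology of its modulus. *)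
Definition dual_group : set (G -> R[i]) :=
  [set gamma | [/\ continuous (gamma : G -> R[i]^o),
    forall x y, gamma (x + y) = gamma x * gamma y &
    forall x, normc (gamma x) = 1]].

Definition ordered_group (P : set G) :=
  [/\ closed P,
      forall x y, P x -> P y -> P (x + y),
      P `&` [set x | P (- x)] = [set 0] &
      P `|` [set x | P (- x)] = setT].

Definition lt_by (P : set G) (x y : G) := P (y - x) /\ x <> y.

Definition archimedean_order (P : set G) :=
  forall x y, lt_by P 0 x -> lt_by P 0 y ->
    exists2 n : nat, (0 < n)%N & lt_by P y (x *+ n).

Definition haar_measure (m : {measure set (borel G) -> \bar R}) :=
  [/\ (m setT != 0)%E,
      forall x (A : set (borel G)), measurable A -> m (+%R x @` A) = m A,
      forall K : set G, compact K -> (m K < +oo)%E,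
      forall A : set (borel G), measurable A ->
        m A = ereal_inf [set m U | U in [set U : set G | open U /\ A `<=` U]] &
      forall U : set G, open U ->
        m U = ereal_sup [set m K | K in [set K : set G | compact K /\ K `<=` U]]].

End groups.

(* A complex measure is a charge with values in [\bar R[i]] (charges are finite
   on measurable sets). Integration is only available for positive measures, so
   a complex measure is split into real and imaginary parts, and these into
   their Jordan parts. *)
Section complex_measure_parts.
Context d (T : measurableType d) (R : realType).
Variable mu : {charge set T -> \bar R[i]}.

Lemma semi_sigma_additive_part (h : R[i] -> R) :
    {morph h : z w / z + w} -> (forall z, `|h z| <= normc z) ->
  semi_sigma_additive (fun A => (h (fine (mu A)))%:E).
Proof.
move=> hD hle F mF tF mUF.
have h0 : h 0 = 0 by apply: (@addIr _ (h 0)); rewrite -hD !add0r.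
have hN z : h (- z) = - h z.
  by apply: (@addIr _ (h z)); rewrite -hD !addNr.
have fin A : measurable A -> mu A = (fine (mu A))%:E.
  by move=> mA; rewrite fineK// fin_num_measure.
have sE n : (\sum_(0 <= i < n) mu (F i) = (\sum_(0 <= i < n) fine (mu (F i)))%R%:E)%E.
  by rewrite -sumEFin; apply: eq_bigr => i _; exact: fin.
have := @charge_semi_sigma_additive _ _ _ mu F mF tF mUF.
rewrite (fin _ mUF) => cv A /nbhs_EFin/nbhs_ballP[e /= e0 eA].
have : nbhs (fine (mu (\bigcup_n F n)))%:E
    [set x : \bar R[i] | A (h (fine x))%:E].
  apply/nbhs_EFin/nbhs_ballP; exists e%:C%C => [|z].
    by rewrite /= ltcR.
  rewrite /ball /= => ze; have {}ze : normc (fine (mu (\bigcup_n F n)) - z) < e.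
    by rewrite -ltcR.
  by apply: eA; rewrite /ball /= -hN -hD; exact: le_lt_trans (hle _) ze.
move=> /cv; rewrite /nbhs /=; apply: filterS => n /=; rewrite sE /= (big_morph _ hD h0).
by rewrite -sumEFin.
Qed.

Definition re_part (A : set T) : \bar R := (complex.Re (fine (mu A)))%:E.
Definition im_part (A : set T) : \bar R := (complex.Im (fine (mu A)))%:E.

Let re_part0 : re_part set0 = 0%E. Proof. by rewrite /re_part charge0. Qed.
Let im_part0 : im_part set0 = 0%E. Proof. by rewrite /im_part charge0. Qed.

Let re_part_fin A : measurable A -> re_part A \is a fin_num. Proof. by []. Qed.
Let im_part_fin A : measurable A -> im_part A \is a fin_num. Proof. by []. Qed.

Let re_part_sigma_additive : semi_sigma_additive re_part.
Proof.
apply: semi_sigma_additive_part => [[a b] [a' b']//|[a b] /=].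
by rewrite -sqrtr_sqr ler_sqrt ?addr_ge0 ?sqr_ge0// lerDl sqr_ge0.
Qed.

Let im_part_sigma_additive : semi_sigma_additive im_part.
Proof.
apply: semi_sigma_additive_part => [[a b] [a' b']//|[a b] /=].
by rewrite -sqrtr_sqr ler_sqrt ?addr_ge0 ?sqr_ge0// lerDr sqr_ge0.
Qed.

HB.instance Definition _ := isCharge.Build d T R re_part
  re_part0 re_part_fin re_part_sigma_additive.
HB.instance Definition _ := isCharge.Build d T R im_part
  im_part0 im_part_fin im_part_sigma_additive.

Definition total_variation (A : set T) : \bar R :=
  ereal_sup [set (\sum_(n <oo) (normc (fine (mu (F n))))%:E)%E | F in
    [set F : (set T)^nat | [/\ forall n, measurable (F n),
                               trivIset setT F & \bigcup_n F n = A]]].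

End complex_measure_parts.

Section complex_integrals.
Context d (T : measurableType d) (R : realType).

Definition complex_integral (nu : {measure set T -> \bar R}) (f : T -> R[i]) :
    R[i] :=
  Complex (\int[nu]_x complex.Re (f x))%R (\int[nu]_x complex.Im (f x))%R.

Definition charge_integral (nu : {charge set T -> \bar R}) (f : T -> R[i]) :
    R[i] :=
  let hahn := svalP (cid (svalP (cid (Hahn_decomposition nu)))) in
  complex_integral (jordan_pos hahn) f - complex_integral (jordan_neg hahn) f.

Definition complex_measure_integral (mu : {charge set T -> \bar R[i]})
    (f : T -> R[i]) : R[i] :=
  charge_integral (re_part mu) f + 'i%C * charge_integral (im_part mu) f.

End complex_integrals.

Section measure_algebra.
Context (R : realType) (G : topologicalZmodType).
Implicit Type mu : {charge set (borel G) -> \bar R[i]}.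

Definition regular_measure mu := forall A : set (borel G), measurable A ->
  total_variation mu A = ereal_inf [set total_variation mu U |
    U in [set U : set G | open U /\ A `<=` U]] /\
  total_variation mu A = ereal_sup [set total_variation mu K |
    K in [set K : set G | compact K /\ K `<=` A]].

Definition concentrated_on mu (P : set G) :=
  forall A : set (borel G), measurable A -> mu A = mu (A `&` P).

Definition fourier_stieltjes mu (gamma : G -> R[i]) : R[i] :=
  complex_measure_integral mu (fun x : borel G => gamma (- x)).

Definition convolution (f : G -> R[i]) mu (x : G) : R[i] :=
  complex_measure_integral mu (fun y : borel G => f (x - y)).

End measure_algebra.

(* The function spaces consist of Borel functions, not of classes modulo a.e.
   equality: [J_norm] is a seminorm which only depends on the class. *)
Section J_spaces.
Context (R : realType) (G : topologicalZmodType).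
Variables (m : {measure set (borel G) -> \bar R}) (p : R) (K P : set G).

Definition L1loc : set (G -> R[i]) :=
  [set f : borel G -> R[i] |
    [/\ measurable_fun setT (fun x => complex.Re (f x)),
        measurable_fun setT (fun x => complex.Im (f x)) &
        forall C : set G, compact C ->
          m.-integrable C (fun x => (normc (f x))%:E)]].

Definition J_norm (f : G -> R[i]) : \bar R :=
  ereal_sup [set ((\int[m]_(y in K) (normc (f (x - y)) `^ p)%:E) `^ p^-1)%E |
    x in [set: G]].

Definition J : set (G -> R[i]) := [set f | L1loc f /\ (J_norm f < +oo)%E].

Definition J_plus : set (G -> R[i]) :=
  [set f | J f /\ {ae m, forall x : borel G, lt_by P x 0 -> f x = 0}].

Hypothesis p1 : 1 <= p.

Lemma J_plus0 : cst 0 \in J_plus.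
Proof.
have p0 : p != 0 by rewrite gt_eqF// (lt_le_trans ltr01).
apply/mem_set; split; last by apply/aeW => x.
split; first split => [||C cC]; first exact: measurable_cst.
- exact: measurable_cst.
- rewrite (_ : (fun _ => _) = cst 0%E); first exact: integrable0.
  by apply/funext => x /=; congr _%:E; exact: normc0.
- have Jx : [set ((\int[m]_(y in K) (normc (cst 0 (x - y) : R[i]) `^ p)%:E)
      `^ p^-1)%E | x in [set: G]] = [set 0%E].
    rewrite (_ : (fun x : G => _) = cst 0%E).
      by rewrite set_cst; case: ifPn => // /eqP/seteqP[/(_ 0)]; case.
    apply/funext => x /=; rewrite integral0_eq ?poweR0r ?invr_eq0// => y _.
    by rewrite /= !expr0n addr0 sqrtr0 powR0.
  by rewrite /J_norm Jx ereal_sup1.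
Qed.

(* The default value 0 of [insubd] plays no role when [P] is an Archimedean order
   on a sigma-compact group and [mu] is concentrated on [P]: then
   [convolution f mu] is in [J_plus] for every [f] in [J_plus]. *)
Definition convolution_operator (mu : {charge set (borel G) -> \bar R[i]})
    (f : J_plus) : J_plus :=
  insubd (exist _ (cst 0) J_plus0 : J_plus) (convolution (val f) mu).

Definition operator_norm (T : J_plus -> J_plus) : \bar R :=
  ereal_sup [set J_norm (val (T f)) | f in
    [set f : J_plus | (J_norm (val f) <= 1)%E]].

End J_spaces.

Arguments dual_group R G : clear implicits.
Arguments convolution_operator {R G} m {p} K P p1 mu f.

(* Main.v *)
(* For a character gamma and c = m(K)^(-1/p), the function f = c 1_P gamma has
   norm at most 1 in J^p(G_+), and
     (f * mu)(x) = c gamma(x) H(x), where H(x) is the integral of gamma(-z)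
   over {z <= x} against mu. The order being Archimedean, there is a sequence
   w n eventually above every element of G. By dominated convergence
   H(w n - y) tends to mu^(gamma) for every y, and Fatou's lemma on K bounds
   the norm of f * mu from below by |mu^(gamma)|.
   Splitting mu into positive measures and the integrands into nonnegative ones
   makes H a combination of monotone functions; this is why f * mu is Borel,
   without Fubini (the Borel sets of G x G need not be generated by rectangles).
*)
Require Import Defs.
From mathcomp Require Import all_boot all_order all_algebra.
From mathcomp Require Import complex.
From mathcomp Require Import all_classical all_reals all_analysis.
From mathcomp Require Import measurable_realfun.

Set Implicit Arguments.
Unset Strict Implicit.
Unset Printing Implicit Defensive.

Import Order.TTheory GRing.Theory Num.Theory numFieldNormedType.Exports.
Import Normc.

Local Open Scope classical_set_scope.
Local Open Scope ring_scope.

(** * Borel measurability of continuous maps on a topological group *)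

Section borel_measurability.
Context (R : realType) (G : topologicalZmodType).

Lemma open_measurable_borel (U : set G) :
  open U -> measurable (U : set (borel G)).
Proof. by move=> oU; exact: sub_sigma_algebra. Qed.

Lemma closed_measurable_borel (F : set G) :
  closed F -> measurable (F : set (borel G)).
Proof.
move=> cF; rewrite -[F]setCK; apply: measurableC.
by apply: open_measurable_borel; exact: closed_openC.
Qed.

Lemma continuous_measurable_borel (f : G -> R) :
  continuous f -> measurable_fun setT (f : borel G -> R).
Proof.
move=> /continuousP cf; apply: (measurability _ (RGenOpens.measurableE R)).
move=> _ [_ [a [b ->]] <-]; rewrite setTI.
by apply: open_measurable_borel; apply: cf; exact: interval_open.
Qed.

Lemma continuous_measurable_borel_endo (f : G -> G) :
  continuous f -> measurable_fun setT (f : borel G -> borel G).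
Proof.
move=> /continuousP cf.
apply: (@measurability _ _ (borel G) (borel G) setT f (@open G)) => //.
by move=> _ [U oU <-]; rewrite setTI; apply: open_measurable_borel; exact: cf.
Qed.

Lemma subl_continuous (x : G) : continuous (fun y : G => x - y).
Proof.
move=> y; apply: (@continuous_comp _ _ _ (fun y => (x, y))
  (fun z : G * G => z.1 - z.2)); last exact: sub_continuous.
by apply: cvg_pair => /=; [exact: cvg_cst|exact: cvg_id].
Qed.

Lemma addl_continuous (x : G) : continuous (fun y : G => x + y).
Proof.
move=> y; apply: (@continuous_comp _ _ _ (fun y => (x, y))
  (fun z : G * G => z.1 + z.2)); last exact: add_continuous.
by apply: cvg_pair => /=; [exact: cvg_cst|exact: cvg_id].
Qed.

Lemma measurable_borel_sub (x : G) :
  measurable_fun setT ((fun y : G => x - y) : borel G -> borel G).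
Proof. exact: continuous_measurable_borel_endo (@subl_continuous x). Qed.

Lemma measurable_borel_opp :
  measurable_fun setT ((fun y : G => - y) : borel G -> borel G).
Proof. exact: continuous_measurable_borel_endo (@tvs.opp_continuous G). Qed.

End borel_measurability.

(** * Monotone functions and cofinal sequences in an ordered group *)

Section ordered_groups.
Context (R : realType) (G : topologicalZmodType) (P : set G).
Hypothesis ordP : ordered_group P.

Let P0 : P 0.
Proof.
by have [_ _ E _] := ordP; have : [set 0 : G] 0 by []; rewrite -E => -[].
Qed.

Let P_total x : P x \/ P (- x).
Proof.
by have [_ _ _ E] := ordP; have : [set: G] x by []; rewrite -E.
Qed.

Lemma ordered_group_anti x : P x -> P (- x) -> x = 0.
Proof.
have [_ _ E _] := ordP; move=> Px PNx.
by have : (P `&` [set x | P (- x)]) x by []; rewrite E.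
Qed.

Lemma ordered_group_closed_le (x : G) : closed [set y | P (x - y)].
Proof.
have [cP _ _ _] := ordP.
apply: (@preimage_closed _ _ (fun y : G => x - y)) => //.
by move=> y _; exact: subl_continuous.
Qed.

(* An up-set is a closed ray if it has a least element, and otherwise it is the
   union of the open rays starting at its elements. *)
Lemma up_set_measurable (U : set G) :
    (forall x y, P (y - x) -> U x -> U y) -> measurable (U : set (borel G)).
Proof.
move=> upU; have [[x0 [Ux0 leU]]|noleast] :=
  pselect (exists x0, U x0 /\ forall x, U x -> P (x - x0)).
  rewrite (_ : U = [set y | P (y - x0)]); last first.
    by apply/seteqP; split => [|y /upU/(_ Ux0)//]; exact: leU.
  apply: closed_measurable_borel; have [cP _ _ _] := ordP.
  apply: (@preimage_closed _ _ (fun y : G => y - x0)) => //.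
  move=> y _.
  have := @addl_continuous _ (- x0) y.
  rewrite (_ : (fun y : G => - x0 + y) = fun y => y - x0)//.
  by apply/funext => z; rewrite addrC.
apply: open_measurable_borel.
rewrite (_ : U = \bigcup_(x in U) ~` [set y | P (x - y)]); last first.
  apply/seteqP; split=> [x Ux|y [x Ux /= nPxy]].
    apply: contrapT => nx; apply: noleast; exists x; split=> // y Uy.
    apply: contrapT => nPyx; by apply: nx; exists y.
  have [|Pyx] := P_total (x - y); first by [].
  by apply: upU Ux; rewrite -opprB.
apply: bigcup_open => x _; apply: closed_openC.
exact: ordered_group_closed_le.
Qed.

(** The sets where [h] exceeds a given real are up-sets, hence Borel, and they determine
    measurability. No continuity or countability is involved, which allows [h] to be an integral
    depending on the endpoint of a half line. *)
Lemma monotone_measurable (h : G -> R) :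
    (forall x y, P (y - x) -> h x <= h y) ->
  measurable_fun setT (h : borel G -> R).
Proof.
move=> mh; apply: (measurability _ (RGenOInfty.measurableE R)).
move=> _ [_ [r ->] <-]; rewrite setTI; apply: up_set_measurable => x y Pyx /=.
by rewrite !in_itv /= !andbT => /lt_le_trans; apply; exact: mh.
Qed.

(** The multiples of one positive element [x0] work: the Archimedean property puts some [x0 *+ n]
    above [z], and adding further copies of [x0] keeps the later multiples above [z]. A sequence is
    needed, rather than a net, for dominated convergence and Fatou's lemma. *)
Lemma cofinal_sequence : archimedean_order P ->
  exists u : G^nat, forall z, \forall n \near \oo, P (u n - z).
Proof.
move=> archP; have [_ PD _ _] := ordP.
(* Without a positive element the group is reduced to 0, and the constant sequence 0 is cofinal. *)
have [[x0 x0_gt0]|nx0] := pselect (exists x0, lt_by P 0 x0); last first.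
  exists (cst 0) => z; apply: nearW => n; rewrite /cst sub0r.
  have [->|/eqP z0] := eqVneq z 0; first by rewrite oppr0.
  have [Pz|//] := P_total z.
  by exfalso; apply: nx0; exists z; split; [rewrite subr0|exact: nesym].
have Px0 : P x0 by have [] := x0_gt0; rewrite subr0.
have PMn k : P (x0 *+ k) by elim: k => [//|k IH]; rewrite mulrS; exact: PD.
exists (fun n => x0 *+ n) => z.
have [Pz|PNz] := P_total z; last first.
  by apply: nearW => n; apply: PD => //; exact: PMn.
have [->|/eqP z0] := eqVneq z 0; first by apply: nearW => n; rewrite subr0.
have [|n _ [Pnz _]] := archP x0 z x0_gt0.
  by split; [rewrite subr0|exact: nesym].
exists n => // k /= nk; rewrite -(subnKC nk) mulrnDr addrAC.
exact: PD.
Qed.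

End ordered_groups.

(** * Complex-valued functions: modulus, convergence and measurability *)

Section complex_valued_functions.
Context (R : realType).
Implicit Types z w : R[i].

Lemma normcE z : normc z = Num.sqrt (complex.Re z ^+ 2 + complex.Im z ^+ 2).
Proof. by case: z. Qed.

Lemma ler_Re_normc z : `|complex.Re z| <= normc z.
Proof. by rewrite normcE -sqrtr_sqr ler_wsqrtr// lerDl sqr_ge0. Qed.

Lemma ler_Im_normc z : `|complex.Im z| <= normc z.
Proof. by rewrite normcE -sqrtr_sqr ler_wsqrtr// lerDr sqr_ge0. Qed.

Lemma normc_le z : normc z <= `|complex.Re z| + `|complex.Im z|.
Proof.
rewrite normcE -[leRHS]ger0_norm ?addr_ge0// -sqrtr_sqr ler_wsqrtr//.
by rewrite sqrrD !real_normK ?num_real// lerD2r lerDl mulrn_wge0// mulr_ge0.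
Qed.

Lemma normc_ge0 z : 0 <= normc z.
Proof. by rewrite normcE sqrtr_ge0. Qed.

Lemma normc_real (a : R) : normc a%:C%C = `|a|.
Proof. by rewrite normcE /= expr0n addr0 sqrtr_sqr. Qed.

Lemma complex_ReM z w : complex.Re (z * w) =
  complex.Re z * complex.Re w - complex.Im z * complex.Im w.
Proof. by case: z; case: w. Qed.

Lemma complex_ImM z w : complex.Im (z * w) =
  complex.Re z * complex.Im w + complex.Im z * complex.Re w.
Proof. by case: z; case: w. Qed.

Lemma Re_realM (a : R) z : complex.Re (a%:C%C * z) = a * complex.Re z.
Proof. by rewrite complex_ReM /= mul0r subr0. Qed.

Lemma Im_realM (a : R) z : complex.Im (a%:C%C * z) = a * complex.Im z.
Proof. by rewrite complex_ImM /= mul0r addr0. Qed.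

Lemma Re_sum n (F : 'I_n -> R[i]) :
  complex.Re (\sum_i F i) = \sum_i complex.Re (F i).
Proof. by apply: (big_morph (@complex.Re R)) => [[a b] [c d]|]. Qed.

Lemma Im_sum n (F : 'I_n -> R[i]) :
  complex.Im (\sum_i F i) = \sum_i complex.Im (F i).
Proof. by apply: (big_morph (@complex.Im R)) => [[a b] [c d]|]. Qed.

(** Convergence is split into real and imaginary parts because [complex_integral] is built from two
    real integrals, to which the limit theorems apply separately. *)
Definition complex_cvg (u : nat -> R[i]) (l : R[i]) :=
  (complex.Re (u n) @[n --> \oo] --> complex.Re l) /\
  (complex.Im (u n) @[n --> \oo] --> complex.Im l).

Lemma complex_cvgMl w u l :
  complex_cvg u l -> complex_cvg (fun n => w * u n) (w * l).
Proof.
move=> [reu imu]; split.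
  rewrite complex_ReM; under eq_fun do rewrite complex_ReM.
  by apply: cvgB; apply: cvgMl_tmp.
rewrite complex_ImM; under eq_fun do rewrite complex_ImM.
by apply: cvgD; apply: cvgMl_tmp.
Qed.

Lemma complex_cvg_sum n (u : 'I_n -> nat -> R[i]) (l : 'I_n -> R[i]) :
    (forall i, complex_cvg (u i) (l i)) ->
  complex_cvg (fun k => \sum_i u i k) (\sum_i l i).
Proof.
have cvg_sum (v : 'I_n -> nat -> R) (a : 'I_n -> R) :
    (forall i, v i k @[k --> \oo] --> a i) ->
    \sum_i v i k @[k --> \oo] --> \sum_i a i.
  move=> va; elim: (index_enum _) => [|i s IH].
    by rewrite big_nil; under eq_fun do rewrite big_nil; exact: cvg_cst.
  by rewrite big_cons; under eq_fun do rewrite big_cons; exact: cvgD.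
move=> ul; split.
  rewrite Re_sum; under eq_fun do rewrite Re_sum.
  by apply: cvg_sum => i; have [] := ul i.
rewrite Im_sum; under eq_fun do rewrite Im_sum.
by apply: cvg_sum => i; have [] := ul i.
Qed.

Lemma complex_cvg_normc u l :
  complex_cvg u l -> normc (u n) @[n --> \oo] --> normc l.
Proof.
move=> [reu imu]; rewrite normcE; under eq_fun do rewrite normcE.
apply: continuous_cvg; first exact: sqrt_continuous.
by apply: cvgD; rewrite expr2; under eq_fun do rewrite expr2; exact: cvgM.
Qed.

Section measurability.
Context d (T : measurableType d).
Implicit Types f g : T -> R[i].

Definition measurable_complex f :=
  measurable_fun setT (fun x => complex.Re (f x)) /\
  measurable_fun setT (fun x => complex.Im (f x)).

Lemma measurable_complex_cst w : measurable_complex (cst w).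
Proof. by split; exact: measurable_cst. Qed.

Lemma measurable_complexM f g : measurable_complex f -> measurable_complex g ->
  measurable_complex (fun x => f x * g x).
Proof.
move=> [ref imf] [reg img]; split.
  under eq_fun do rewrite complex_ReM.
  by apply: measurable_funB; exact: measurable_funM.
under eq_fun do rewrite complex_ImM.
by apply: measurable_funD; exact: measurable_funM.
Qed.

Lemma measurable_complex_real (h : T -> R) : measurable_fun setT h ->
  measurable_complex (fun x => (h x)%:C%C).
Proof. by move=> mh; split => //=; exact: measurable_cst. Qed.

Lemma measurable_complex_sum n (F : 'I_n -> T -> R[i]) :
    (forall i, measurable_complex (F i)) ->
  measurable_complex (fun x => \sum_i F i x).
Proof.
move=> mF; split.
  under eq_fun do rewrite Re_sum.
  by apply: measurable_sum => i; have [] := mF i.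
under eq_fun do rewrite Im_sum.
by apply: measurable_sum => i; have [] := mF i.
Qed.

Lemma measurable_normc f : measurable_complex f ->
  measurable_fun setT (fun x => normc (f x)).
Proof.
move=> [ref imf]; under eq_fun do rewrite normcE.
apply: (measurableT_comp (continuous_measurable_fun (@sqrt_continuous R))).
by apply: measurable_funD; exact: measurable_funX.
Qed.

End measurability.

Lemma measurable_complex_comp d d' (T : measurableType d)
    (T' : measurableType d') (f : T -> R[i]) (h : T' -> T) :
    measurable_complex f -> measurable_fun setT h ->
  measurable_complex (f \o h).
Proof.
by move=> [ref imf] mh; split;
  [exact: (measurableT_comp ref mh)|exact: (measurableT_comp imf mh)].
Qed.

(** * Integrals of bounded functions against a finite measure *)

Section finite_measure.
Context d (T : measurableType d) (nu : {finite_measure set T -> \bar R}).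

Lemma finite_measure_bounded_integrable (f : T -> R) M :
    measurable_fun setT f -> (forall x, `|f x| <= M) ->
  nu.-integrable setT (EFin \o f).
Proof.
move=> mf fM; apply: measurable_bounded_integrable => //.
  by rewrite ltey_eq fin_num_measure.
by exists M; split; [exact: num_real|move=> N /ltW MN x _; exact: le_trans MN].
Qed.

Lemma Rintegral_norm_bounded (f : T -> R) M :
    measurable_fun setT f -> (forall x, `|f x| <= M) ->
  `|\int[nu]_x f x| <= M * fine (nu setT).
Proof.
move=> mf fM; have intf := finite_measure_bounded_integrable mf fM.
apply: le_trans (le_normr_Rintegral _ intf) _ => //.
rewrite -Rintegral_cst//; apply: le_Rintegral => //.
  by apply: integrable_norm.
apply: (@finite_measure_bounded_integrable _ `|M|) => //.
Qed.

Variables (g : T -> R[i]) (M : R).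
Hypotheses (mg : measurable_complex g) (gM : forall x, normc (g x) <= M).

Let complex_ReM' x : `|complex.Re (g x)| <= M.
Proof. exact: le_trans (ler_Re_normc _) (gM x). Qed.

Let complex_ImM' x : `|complex.Im (g x)| <= M.
Proof. exact: le_trans (ler_Im_normc _) (gM x). Qed.

Let intRe : nu.-integrable setT (EFin \o (fun x => complex.Re (g x))).
Proof. exact: finite_measure_bounded_integrable mg.1 complex_ReM'. Qed.

Let intIm : nu.-integrable setT (EFin \o (fun x => complex.Im (g x))).
Proof. exact: finite_measure_bounded_integrable mg.2 complex_ImM'. Qed.

Lemma complex_integralZl w :
  complex_integral nu (fun x => w * g x) = w * complex_integral nu g.
Proof.
have intZ (a : R) h : nu.-integrable setT (EFin \o h) ->
    nu.-integrable setT (EFin \o (fun x => a * h x)).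
  by move=> inth; exact: (integrableZl measurableT a inth).
apply/eqP; rewrite eq_complex; apply/andP; split; apply/eqP.
  rewrite complex_ReM /=; under eq_Rintegral do rewrite complex_ReM.
  by rewrite RintegralB// ?RintegralZl//; exact: intZ.
rewrite complex_ImM /=; under eq_Rintegral do rewrite complex_ImM.
by rewrite RintegralD// ?RintegralZl//; exact: intZ.
Qed.

(** The factor 2 comes from bounding the real and imaginary parts separately; the bound only serves
    to show that certain integrals are bounded functions of a parameter. *)
Lemma normc_complex_integral_le :
  normc (complex_integral nu g) <= 2 * M * fine (nu setT).
Proof.
apply: le_trans (normc_le _) _; rewrite /= -mulrA mulr_natl mulr2n.
by apply: lerD; apply: Rintegral_norm_bounded; [exact: mg.1| |exact: mg.2|].
Qed.

End finite_measure.

End complex_valued_functions.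

(** * Decomposition of a complex measure into four finite positive measures *)

Section jordan_parts.
Context (R : realType) d (T : measurableType d).

(** The Jordan parts are, up to sign, the restrictions of [nu] to the two sets of a Hahn
    decomposition. Since [nu] vanishes on every measurable subset of the complement of [Q], both
    parts give that complement measure 0. *)
Lemma charge_integralE (nu : {charge set T -> \bar R}) (Q : set T) :
    measurable Q -> (forall A, measurable A -> nu A = nu (A `&` Q)) ->
  exists nup nun : {finite_measure set T -> \bar R},
    [/\ nup (~` Q) = 0%E, nun (~` Q) = 0%E &
        forall f, charge_integral nu f =
                  complex_integral nup f - complex_integral nun f].
Proof.
move=> mQ nuQ.
pose hahn := svalP (cid (svalP (cid (Hahn_decomposition nu)))).
have mCQ := measurableC mQ.
have nu0 A : measurable A -> nu (~` Q `&` A) = 0%E.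
  move=> mA; rewrite nuQ; last exact: measurableI.
  by rewrite setIAC setICl set0I charge0.
have [[mPos _] [mNeg _] _ _] := hahn.
exists (jordan_pos hahn), (jordan_neg hahn); split=> //.
  apply: eq_trans (jordan_posE hahn (~` Q)) _.
  by rewrite cjordan_posE /crestr0 mem_set// /crestr nu0.
apply: eq_trans (jordan_negE hahn (~` Q)) _.
by rewrite cjordan_negE /crestr0 mem_set// /crestr nu0// oppe0.
Qed.

(** Splitting the real and imaginary parts of [mu] into Jordan parts produces the coefficients 1, i,
    -1, -i, that is, the powers of i. *)
Lemma complex_measure_integralE (mu : {charge set T -> \bar R[i]}) (Q : set T) :
    measurable Q -> (forall A, measurable A -> mu A = mu (A `&` Q)) ->
  exists nu : 'I_4 -> {finite_measure set T -> \bar R},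
    (forall j, nu j (~` Q) = 0%E) /\
    forall f, complex_measure_integral mu f =
              \sum_(j < 4) 'i%C ^+ j * complex_integral (nu j) f.
Proof.
move=> mQ muQ.
have [|rp [rn [rp0 rn0 rE]]] := @charge_integralE (re_part mu) Q mQ.
  by move=> A mA; congr (complex.Re (fine _))%:E; exact: muQ.
have [|jp [jn [jp0 jn0 jE]]] := @charge_integralE (im_part mu) Q mQ.
  by move=> A mA; congr (complex.Im (fine _))%:E; exact: muQ.
(* The positive parts come first and the negative ones last, so that position [j] carries the
   coefficient ['i ^+ j]. *)
exists (fun j : 'I_4 => nth rp [:: rp; jp; rn; jn] j); split.
  by case=> [[|[|[|[|]]]]].
move=> f; rewrite /complex_measure_integral rE jE !big_ord_recl big_ord0 /=.
rewrite expr0 mul1r expr1 exprS expr1 exprS exprS expr1.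
have ii : 'i%C * 'i%C = -1 :> R[i] by rewrite -expr2 sqr_i.
rewrite ii mulrN1 addr0 mulrBr mulN1r mulNr addrACA -!addrA; congr (_ + _).
Qed.

End jordan_parts.

(** * Positivity of Haar measure on compact neighbourhoods *)

Section haar.
Context (R : realType) (G : topologicalZmodType).
Hypothesis hausdorffG : hausdorff_space G.
Variable m : {measure set (borel G) -> \bar R}.
Hypothesis haar_m : haar_measure m.

Lemma compact_measurable_borel (K : set G) :
  compact K -> measurable (K : set (borel G)).
Proof. by move=> /compact_closed-/(_ hausdorffG)/closed_measurable_borel. Qed.

(** If [K] were null, so would be all translates of its interior. Finitely many of them cover each
    of the countably many compact sets exhausting [G], so the whole group would be null. *)
Lemma haar_measure_gt0 (K : set G) : sigma_compact G -> compact K ->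
  interior K !=set0 -> (0 < m K)%E.
Proof.
have [m_neq0 m_inv _ _ _] := haar_m.
move=> [F cF FT] cK [x0 Kx0]; rewrite lt_neqAle measure_ge0 andbT eq_sym.
apply/eqP => mK0; move/eqP: m_neq0; apply.
pose V := interior K : set (borel G).
have oV : open V by exact: open_interior.
have mV : measurable V by exact: open_measurable_borel.
have V0 : m.-negligible V.
  apply: (@negligibleS _ (borel G) R m K V); first exact: interior_subset.
  by apply/negligibleP => //; exact: compact_measurable_borel.
have translateE (x : G) : +%R x @` V = [set y | V (y - x)].
  apply/seteqP; split => [_ [v Vv <-]|y Vy].
    by rewrite /= addrAC subrr add0r.
  by exists (y - x) => //; rewrite addrC subrK.
have oVx (x : G) : open [set y : G | V (y - x)].
  have /continuousP := @addl_continuous G (- x); move=> /(_ _ oV).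
  by congr open; apply/seteqP; split => y /=; rewrite addrC.
have Vx0 (x : G) : m.-negligible [set y | V (y - x)].
  apply/negligibleP; first by apply: open_measurable_borel; exact: oVx.
  rewrite -translateE.
  exact: eq_trans (m_inv x V mV) (measure_negligible mV V0).
apply: measure_negligible => //; rewrite -FT; apply: negligible_bigcup => n.
have : @cover_compact (borel G) (F n) by rewrite -compact_cover; exact: cF.
move=> /(_ (borel G) setT (fun x => [set y | V (y - x)])) [|y Fy|D _ FD].
- by move=> x _; exact: oVx.
(* Translating by [y - x0] moves the interior point [x0] of [K] to [y]. *)
- by exists (y - x0) => //=; rewrite opprB addrC subrK.
apply: negligibleS FD _; rewrite /cover bigcup_fset.
by elim/big_ind : _ => //; [exact: negligible_set0|exact: negligibleU].
Qed.

End haar.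

(** * Integrals over the half lines of all z with z <= x *)

Section half_line_integrals.
Context (R : realType) (G : topologicalZmodType) (P : set G).
Hypothesis ordP : ordered_group P.
Variable nu : {finite_measure set (borel G) -> \bar R}.

Lemma measurable_half_line_indic (x : G) :
  measurable_fun setT ((fun z : G => \1_P (x - z)) : borel G -> R).
Proof.
have [cP _ _ _] := ordP.
apply: (measurableT_comp (measurable_indic (closed_measurable_borel cP))).
exact: measurable_borel_sub.
Qed.

Lemma half_line_indicM_le (g : G -> R) M (x z : G) : `|g z| <= M ->
  `|\1_P (x - z) * g z| <= M.
Proof.
move=> gM; rewrite normrM; apply: le_trans gM.
by rewrite indicE ler_piMl//; case: (_ \in _); rewrite ?normr1 ?normr0.
Qed.

(** For a nonnegative integrand the integral increases with [x], because the half line below [x]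
    grows, and monotone functions are Borel. A bounded [g] is reduced to this case by adding a
    constant. *)
Lemma half_line_Rintegral_measurable (g : G -> R) M :
    measurable_fun setT (g : borel G -> R) -> (forall z, `|g z| <= M) ->
  measurable_fun setT ((fun x : G => \int[nu]_z (\1_P (x - z) * g z))
    : borel G -> R).
Proof.
move=> mg gM.
have intP (h : G -> R) N x : measurable_fun setT (h : borel G -> R) ->
    (forall z, `|h z| <= N) ->
    nu.-integrable setT (EFin \o (fun z : borel G => \1_P (x - z) * h z)).
  move=> mh hN; apply: (@finite_measure_bounded_integrable _ _ _ _ _ N) => [|z].
    by apply: measurable_funM => //; exact: measurable_half_line_indic.
  exact: half_line_indicM_le.
have mon (h : G -> R) N : measurable_fun setT (h : borel G -> R) ->
    (forall z, `|h z| <= N) -> (forall z, 0 <= h z) ->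
    measurable_fun setT ((fun x : G => \int[nu]_z (\1_P (x - z) * h z))
      : borel G -> R).
  move=> mh hN h0; apply: (monotone_measurable ordP) => x y Pyx.
  apply: le_Rintegral => //; [exact: intP hN|exact: intP hN|].
  move=> z _; rewrite ler_wpM2r// !indicE.
  have [Pxz|//] := boolP (x - z \in P); rewrite mem_set//.
  have [_ PD _ _] := ordP.
  by rewrite -(subrK x y) -addrA; apply: PD => //; exact: set_mem.
have M0 : 0 <= M by exact: le_trans (gM 0).
have mM : measurable_fun setT (cst M : borel G -> R) by exact: measurable_cst.
have mgM : measurable_fun setT ((fun z : G => g z + M) : borel G -> R).
  exact: measurable_funD.
have gM0 z : 0 <= g z + M.
  by rewrite -lerBlDr sub0r; have := gM z; rewrite ler_norml => /andP[].
have gM2 z : `|g z + M| <= M + M.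
  by rewrite (le_trans (ler_normD _ _))// lerD// ger0_norm.
(* [g = (g + M) - M] is a difference of nonnegative functions. *)
rewrite (_ : (fun x => _) = fun x => \int[nu]_z (\1_P (x - z) * (g z + M)) -
    \int[nu]_z (\1_P (x - z) * cst M z)).
  by apply: measurable_funB; [exact: mon gM2 _|apply: (mon _ M) => //= _;
    rewrite ger0_norm].
apply/funext => x; rewrite -RintegralB//.
- by apply: eq_Rintegral => z _ /=; rewrite -mulrBr addrK.
- exact: intP gM2.
- by apply: (intP _ M) => //= _; rewrite ger0_norm.
Qed.

(** Dominated convergence: for each [z] the indicator is eventually 1, and the constant [M] is
    integrable because [nu] is finite. *)
Lemma half_line_Rintegral_cvg (g : G -> R) M (w : G^nat) :
    measurable_fun setT (g : borel G -> R) -> (forall z, `|g z| <= M) ->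
    (forall z, \forall n \near \oo, P (w n - z)) ->
  \int[nu]_z (\1_P (w n - z) * g z) @[n --> \oo] --> \int[nu]_z g z.
Proof.
move=> mg gM wP; apply: fine_cvg; rewrite fineK; last first.
  apply: integrable_fin_num => //.
  exact: (finite_measure_bounded_integrable nu mg gM).
have [|||||_ _ //] := @dominated_convergence _ _ _ nu setT measurableT
    (fun n z => (\1_P (w n - z) * g z)%:E) (EFin \o g) (cst M%:E).
- move=> n; apply/measurable_EFinP; apply: measurable_funM => //.
  exact: measurable_half_line_indic.
- exact/measurable_EFinP.
- apply: aeW => z _; apply: cvg_near_cst; near=> n.
  by rewrite indicE mem_set ?mul1r//; near: n; exact: wP.
- by apply: (@finite_measure_bounded_integrable _ _ _ nu (cst M) `|M|).
- by apply: aeW => z n _ /=; rewrite lee_fin half_line_indicM_le.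
Unshelve. all: by end_near. Qed.

Variables (g : G -> R[i]) (M : R).
Hypotheses (mg : measurable_complex (g : borel G -> R[i]))
  (gM : forall z, normc (g z) <= M).

(** The half line enters through an indicator, so that the domain of integration does not depend on
    [x]. *)
Definition half_line_integral (x : G) : R[i] :=
  complex_integral nu (fun z : borel G => (\1_P (x - z))%:C%C * g z).

Let Re_half_line_integral : (fun x => complex.Re (half_line_integral x)) =
  fun x => \int[nu]_z (\1_P (x - z) * complex.Re (g z)).
Proof. by apply/funext => x; apply: eq_Rintegral => z _; exact: Re_realM. Qed.

Let Im_half_line_integral : (fun x => complex.Im (half_line_integral x)) =
  fun x => \int[nu]_z (\1_P (x - z) * complex.Im (g z)).
Proof. by apply/funext => x; apply: eq_Rintegral => z _; exact: Im_realM. Qed.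

Lemma half_line_integral_measurable :
  measurable_complex (half_line_integral : borel G -> R[i]).
Proof.
split.
  rewrite Re_half_line_integral.
  apply: (half_line_Rintegral_measurable (M := M)); first exact: mg.1.
  by move=> z; exact: le_trans (ler_Re_normc _) (gM z).
rewrite Im_half_line_integral.
apply: (half_line_Rintegral_measurable (M := M)); first exact: mg.2.
by move=> z; exact: le_trans (ler_Im_normc _) (gM z).
Qed.

Lemma half_line_integral_cvg (w : G^nat) :
    (forall z, \forall n \near \oo, P (w n - z)) ->
  complex_cvg (half_line_integral \o w) (complex_integral nu g).
Proof.
move=> wP; split.
  rewrite (funext (fun n => congr1 (@^~ (w n)) Re_half_line_integral)).
  apply: (half_line_Rintegral_cvg (M := M)) => //; first exact: mg.1.
  by move=> z; exact: le_trans (ler_Re_normc _) (gM z).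
rewrite (funext (fun n => congr1 (@^~ (w n)) Im_half_line_integral)).
apply: (half_line_Rintegral_cvg (M := M)) => //; first exact: mg.2.
by move=> z; exact: le_trans (ler_Im_normc _) (gM z).
Qed.

Lemma measurable_half_line_indicM (x : G) : measurable_complex
  ((fun z : G => (\1_P (x - z))%:C%C * g z) : borel G -> R[i]).
Proof.
apply: measurable_complexM => //.
exact: measurable_complex_real (measurable_half_line_indic x).
Qed.

Lemma normc_half_line_indicM (x z : G) :
  normc ((\1_P (x - z))%:C%C * g z) <= M.
Proof.
rewrite normcM normc_real; apply: le_trans (gM z).
by rewrite indicE ler_piMl ?normc_ge0//; case: (_ \in _);
  rewrite ?normr1 ?normr0.
Qed.

End half_line_integrals.

(** If [z] and [x - z] both lie in [P], so does their sum [x]. Hence for [x] outside [P] the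
    integrand vanishes on [P], whose complement is null for [nu]. *)
Lemma half_line_integral_eq0 (R : realType) (G : topologicalZmodType)
    (P : set G) (nu : {finite_measure set (borel G) -> \bar R})
    (g : G -> R[i]) (x : G) :
    ordered_group P -> nu (~` P) = 0%E ->
    measurable_complex (g : borel G -> R[i]) ->
  ~ P x -> half_line_integral P nu g x = 0.
Proof.
move=> ordP nuP mg nPx; have [cP PD _ _] := ordP.
have mgx := measurable_half_line_indicM ordP mg x.
have int0 (h : borel G -> R) : measurable_fun setT h ->
    (forall z, P z -> h z = 0) -> \int[nu]_z h z = 0.
  move=> mh h0; rewrite /Rintegral (ae_eq_integral (cst 0%E)) ?integral0//.
  - exact/measurable_EFinP.
  - exists (~` P); split => //.
    + by apply: measurableC; exact: closed_measurable_borel.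
    + by move=> z /= nz Pz; apply: nz => _; rewrite h0.
have indic0 z : P z -> (\1_P (x - z))%:C%C * g z = 0.
  move=> Pz; rewrite indicE memNset ?mul0r// => Pxz; apply: nPx.
  by rewrite -(subrK z x); exact: PD.
apply/eqP; rewrite eq_complex; apply/andP; split; apply/eqP;
  apply: int0 => [|z Pz]; rewrite ?indic0//; [exact: mgx.1|exact: mgx.2].
Qed.

(** * Upper and lower bounds for the norm of J^p *)

Section J_space_bounds.
Context (R : realType) (G : topologicalZmodType).
Variables (m : {measure set (borel G) -> \bar R}) (p : R) (K : set G).
Hypotheses (hausdorffG : hausdorff_space G) (haar_m : haar_measure m).
Hypotheses (p1 : 1 <= p) (compactK : compact K).

Let p0 : 0 < p. Proof. exact: lt_le_trans p1. Qed.

Lemma measurable_powR_normc (f : G -> R[i]) (x : G) :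
    measurable_complex (f : borel G -> R[i]) ->
  measurable_fun (K : set (borel G))
    (fun y : borel G => normc (f (x - y)) `^ p).
Proof.
move=> mf; apply: measurable_funTS.
apply: (measurableT_comp (measurable_powR _)).
apply: measurable_normc.
exact: (measurable_complex_comp mf (measurable_borel_sub x)).
Qed.

Lemma J_norm_le (f : G -> R[i]) M :
    measurable_complex (f : borel G -> R[i]) -> (forall x, normc (f x) <= M) ->
  (J_norm m p K f <= ((M `^ p)%:E * m K) `^ p^-1)%E.
Proof.
move=> mf fM; have mK := compact_measurable_borel hausdorffG compactK.
apply: ge_ereal_sup => _ [x _ <-].
have int0 : (0 <= \int[m]_(y in K) (normc (f (x - y)) `^ p)%:E)%E.
  by apply: integral_ge0 => y _; rewrite lee_fin powR_ge0.
apply: gt0_ler_poweR.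
- by rewrite invr_ge0 ltW.
- by rewrite in_itv /= int0 leey.
- by rewrite in_itv /= leey andbT mule_ge0// lee_fin powR_ge0.
rewrite -integral_cst//; apply: ge0_le_integral => //.
- by move=> y _; rewrite lee_fin powR_ge0.
- by apply/measurable_EFinP; exact: measurable_powR_normc.
- by move=> y _; rewrite lee_fin ge0_ler_powR ?nnegrE ?normc_ge0 ?(ltW p0)//;
    exact: le_trans (normc_ge0 _) (fM 0).
Qed.

Lemma bounded_J (f : G -> R[i]) M :
    measurable_complex (f : borel G -> R[i]) -> (forall x, normc (f x) <= M) ->
  J m p K f.
Proof.
move=> mf fM; have [_ _ fin_m _ _] := haar_m; split.
  split; [exact: mf.1|exact: mf.2|move=> C cC].
  have mC := compact_measurable_borel hausdorffG cC.
  apply: (@measurable_bounded_integrable _ (borel G) R m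
    (fun x => normc (f x)) C mC).
  - exact: fin_m.
  - by apply: measurable_funTS; exact: measurable_normc.
  - exists M; split; first exact: num_real.
    move=> N /ltW MN x _ /=.
    by rewrite ger0_norm ?normc_ge0// (le_trans (fM x)).
apply: le_lt_trans (J_norm_le mf fM) _; apply: poweR_lty.
by rewrite lte_mul_pinfty ?lee_fin ?powR_ge0// fin_m.
Qed.

(** Fatou's lemma on [K] along the points [w n]: the integral of the limit [a ^ p] is at most the
    lower limit of the integrals at [w n], and each of these is at most the p-th power of the
    norm. *)
Lemma J_norm_ge (f : G -> R[i]) (a : R) (w : G^nat) :
    measurable_complex (f : borel G -> R[i]) -> 0 < a ->
    (forall y, normc (f (w n - y)) @[n --> \oo] --> a) ->
  (((a `^ p)%:E * m K) `^ p^-1 <= J_norm m p K f)%E.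
Proof.
move=> mf a0 fw; have mK := compact_measurable_borel hausdorffG compactK.
have J0 : (0 <= J_norm m p K f)%E.
  by apply: le_trans (ereal_sup_ubound _); last (exists 0 => //);
    exact: poweR_ge0.
have powK (x : \bar R) (q : R) :
    q != 0 -> (0 <= x)%E -> ((x `^ q) `^ q^-1)%E = x.
  by move=> q0 x0; rewrite -poweRrM mulfV// poweRe1.
have p_neq0 : p != 0 by rewrite gt_eqF.
(* Writing the norm as the root of its p-th power reduces the claim to an inequality between p-th
   powers. *)
rewrite -[leRHS](powK _ _ p_neq0 J0); apply: gt0_ler_poweR.
- by rewrite invr_ge0 ltW.
- by rewrite in_itv /= leey andbT mule_ge0// lee_fin powR_ge0.
- by rewrite in_itv /= leey andbT poweR_ge0.
have pow_cvg y : ((normc (f (w n - y)) `^ p)%:E @[n --> \oo] --> (a `^ p)%:E)%E.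
  (* Continuity of the power at [a] is deduced from derivability, which is where [a] has to be
     positive. *)
  have ca : {for a, continuous (fun b : R => b `^ p)}.
    apply: differentiable_continuous; apply/derivable1_diffP.
    by apply: derivable_powR; rewrite in_itv /= andbT.
  have cvg_pow : normc (f (w n - y)) `^ p @[n --> \oo] --> a `^ p.
    exact: (cvg_comp _ _ (fw y) ca).
  by apply: cvg_EFin => //; exact: nearW.
rewrite -integral_cst//.
have -> : (\int[m]_(x in K) cst (a `^ p)%:E x =
    \int[m]_(y in K) limn_einf (fun n => (normc (f (w n - y)) `^ p)%:E))%E.
  by apply: eq_integral => y _; rewrite (cvg_limn_einf_sup (pow_cvg y)).1.
apply: (le_trans (fatou _ mK _ _)).
- by move=> n; apply/measurable_EFinP; exact: measurable_powR_normc.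
- by move=> n y _; rewrite lee_fin powR_ge0.
(* The lower limit is the limit of the infima over the tails, and each infimum is at most the first
   term of its tail. *)
rewrite limn_einf_lim; apply: lime_le; first exact: is_cvg_einfs.
apply: nearW => n; apply: (@le_trans _ _
  (\int[m]_(y in K) (normc (f (w n - y)) `^ p)%:E)%E).
  by apply: ereal_inf_lbound; exists n => /=.
have int0 : (0 <= \int[m]_(y in K) (normc (f (w n - y)) `^ p)%:E)%E.
  by apply: integral_ge0 => y _; rewrite lee_fin powR_ge0.
rewrite -[leLHS](powK _ p^-1 _ int0) ?invr_neq0// invrK.
apply: gt0_ler_poweR.
- exact: ltW.
- by rewrite in_itv /= leey andbT poweR_ge0.
- by rewrite in_itv /= leey andbT.
by apply: ereal_sup_ubound; exists (w n).
Qed.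

End J_space_bounds.

(** * Characters, and their truncations to the positive cone *)

Lemma continuous_measurable_complex (R : realType) (G : topologicalZmodType)
    (gamma : G -> R[i]) : continuous (gamma : G -> R[i]^o) ->
  measurable_complex (gamma : borel G -> R[i]).
Proof.
move=> cgamma.
(* The real and imaginary parts are treated at once, as additive maps that do not increase the
   modulus. *)
have part (h : R[i] -> R) : (forall z w, h (z - w) = h z - h w) ->
    (forall z, `|h z| <= normc z) ->
    measurable_fun setT (h \o gamma : borel G -> R).
  move=> hB hle; apply: continuous_measurable_borel => x.
  apply/cvgrPdist_lt => e e0; have e0C : 0 < e%:C%C by rewrite ltcR.
  have /cvgrPdist_lt/(_ _ e0C) := cgamma x.
  by apply: filterS => y; rewrite /= -hB ltcR; exact: le_lt_trans.
split.
  by apply: (part (@complex.Re R)); [case=> [a b] [c d]|exact: ler_Re_normc].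
by apply: (part (@complex.Im R)); [case=> [a b] [c d]|exact: ler_Im_normc].
Qed.

Lemma normc_sum_le (R : realType) n (F : 'I_n -> R[i]) :
  normc (\sum_i F i) <= \sum_i normc (F i).
Proof.
elim/big_ind2 : _ => // [|z a w b za wb]; first by rewrite normc0.
by apply: le_trans (lerD za wb); exact: le_normcD.
Qed.

Section truncated_character.
Context (R : realType) (G : topologicalZmodType) (P : set G).
Hypothesis ordP : ordered_group P.
Variable mu : {charge set (borel G) -> \bar R[i]}.
Hypothesis mu_P : concentrated_on mu P.
Variable gamma : G -> R[i].
Hypothesis dual_gamma : dual_group R G gamma.
Variable c : R.

Definition truncated_character (x : G) : R[i] :=
  c%:C%C * ((\1_P x)%:C%C * gamma x).

Let mP : measurable (P : set (borel G)).
Proof. by have [cP _ _ _] := ordP; exact: closed_measurable_borel. Qed.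

Let mgamma : measurable_complex (gamma : borel G -> R[i]).
Proof.
by have [cgamma _ _] := dual_gamma; exact: continuous_measurable_complex.
Qed.

(** This is the integrand of the Fourier-Stieltjes transform at [gamma]. *)
Let g (z : G) : R[i] := gamma (- z).

Let mg : measurable_complex (g : borel G -> R[i]).
Proof. exact: (measurable_complex_comp mgamma (@measurable_borel_opp G)). Qed.

Let normg z : normc (g z) <= 1.
Proof. by have [_ _ ->] := dual_gamma. Qed.

Lemma truncated_character_measurable :
  measurable_complex (truncated_character : borel G -> R[i]).
Proof.
apply: measurable_complexM; first exact: measurable_complex_cst.
apply: measurable_complexM => //.
by apply: measurable_complex_real; exact: measurable_indic.
Qed.

Lemma normc_truncated_character_le x : normc (truncated_character x) <= `|c|.
Proof.
have [_ _ ngamma] := dual_gamma.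
rewrite !normcM !normc_real ngamma mulr1 ler_piMr//.
by rewrite indicE; case: (_ \in _); rewrite ?normr1 ?normr0.
Qed.

(** Since gamma(x - z) = gamma(x) gamma(-z), the factor gamma(x) leaves the convolution integral,
    and [H] is what remains. Its measurability, its boundedness and its vanishing off [P] put the
    convolution in [J_plus]; its limit along cofinal sequences yields the lower bound. *)
Lemma convolution_truncated_character :
  exists H : G -> R[i],
    [/\ measurable_complex (H : borel G -> R[i]),
        exists M, forall x, normc (H x) <= M,
        forall x, ~ P x -> H x = 0,
        forall w : G^nat, (forall z, \forall n \near \oo, P (w n - z)) ->
          complex_cvg (H \o w) (fourier_stieltjes mu gamma) &
        forall x, convolution truncated_character mu x =
                  c%:C%C * gamma x * H x].
Proof.
have [_ gammaD _] := dual_gamma.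
have [nu [nuP nuE]] := complex_measure_integralE mP mu_P.
have mgx (x : G) := measurable_half_line_indicM ordP mg x.
have ngx (x : G) := normc_half_line_indicM P normg x.
exists (fun x => \sum_(j < 4) 'i%C ^+ j * half_line_integral P (nu j) g x).
split.
- apply: measurable_complex_sum => j; apply: measurable_complexM.
    exact: measurable_complex_cst.
  exact: half_line_integral_measurable normg.
- exists (\sum_(j < 4) normc ('i%C ^+ j : R[i]) * (2 * 1 * fine (nu j setT))).
  move=> x.
  apply: le_trans (normc_sum_le _) _; apply: ler_sum => j _.
  rewrite normcM ler_wpM2l ?normc_ge0//.
  exact: normc_complex_integral_le.
- move=> x nPx; rewrite big1// => j _.
  by rewrite (half_line_integral_eq0 ordP (nuP j))// mulr0.
- move=> w wP; rewrite /fourier_stieltjes nuE.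
  apply: complex_cvg_sum => j; apply: complex_cvgMl.
  exact: half_line_integral_cvg normg _ wP.
move=> x; rewrite /convolution nuE mulr_sumr; apply: eq_bigr => j _.
rewrite mulrCA -(complex_integralZl _ (mgx x) (ngx x)); congr (_ * _).
congr complex_integral; apply/funext => z.
rewrite /truncated_character /g gammaD -!mulrA; congr (_ * _).
by rewrite mulrCA.
Qed.

End truncated_character.

(** * Testing the operator norm on a normalised truncated character *)

Theorem theorem8 (R : realType) (G : topologicalZmodType)
    (hausdorffG : hausdorff_space G)
    (lcG : locally_compact [set: G])
    (scG : sigma_compact G)
    (P : set G) (ordP : ordered_group P) (archP : archimedean_order P)
    (m : {measure set (borel G) -> \bar R}) (haar_m : haar_measure m)
    (p : R) (p1 : 1 <= p)
    (K : set G) (compactK : compact K) (nbhsK : interior K !=set0)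
    (mu : {charge set (borel G) -> \bar R[i]})
    (regular_mu : regular_measure mu) (mu_P : concentrated_on mu P) :
  (ereal_sup [set (normc (fourier_stieltjes mu gamma))%:E |
              gamma in dual_group R G]
   <= operator_norm (convolution_operator m K P p1 mu))%E.
Proof.
have p0 : 0 < p by exact: lt_le_trans p1.
have p_neq0 : p != 0 by rewrite gt_eqF.
have mK_gt0 := haar_measure_gt0 hausdorffG haar_m scG compactK nbhsK.
have [_ _ fin_m _ _] := haar_m.
have mK_fin : m K \is a fin_num by rewrite ge0_fin_numE// fin_m.
have [k k_gt0 mKE] : exists2 k, 0 < k & m K = k%:E.
  by exists (fine (m K)); rewrite ?fineK// fine_gt0// mK_gt0 fin_m.
apply: ge_ereal_sup => _ [gamma dual_gamma <-].
have [cgamma gammaD ngamma] := dual_gamma.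
set B := normc _.
pose c : R := k `^ (- p^-1).
have c_gt0 : 0 < c by exact: powR_gt0.
(* The choice of [c] cancels m(K): with [b = 1] this bounds the norm of [f] by 1, and with [b = B]
   it evaluates the lower bound for the convolution. *)
have scale (b : R) : 0 <= b -> (((((c * b) `^ p)%:E * m K) `^ p^-1)%E = b%:E).
  move=> b0; rewrite mKE -EFinM poweR_EFin powRM ?(ltW c_gt0)// -powRrM mulNr.
  rewrite mulVf// powR_inv1 ?ltW// mulrAC mulVf ?gt_eqF// mul1r -powRrM.
  by rewrite mulfV// powRr1.
pose f := truncated_character P gamma c.
have mf := truncated_character_measurable ordP dual_gamma c.
have nf x : normc (f x) <= c.
  rewrite -[leRHS](ger0_norm (ltW c_gt0)).
  exact: normc_truncated_character_le.
have Jf : J_plus m p K P f.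
  split; first exact: (bounded_J hausdorffG haar_m p1 compactK mf nf).
  apply: aeW => x [PNx x0]; rewrite /f /truncated_character indicE memNset.
    by rewrite mul0r mulr0.
  by move=> Px; apply: x0; apply: (ordered_group_anti ordP) => //; rewrite -sub0r.
have Jf_le1 : (J_norm m p K f <= 1)%E.
  have := J_norm_le m hausdorffG p1 compactK mf nf; move=> /le_trans; apply.
  by rewrite -[c in (c `^ p)%:E]mulr1 scale.
have [H [mH [M HM] H0 Hcvg Hconv]] :=
  convolution_truncated_character ordP mu_P dual_gamma c.
have [w wP] := cofinal_sequence ordP archP.
have nconv x : normc (convolution f mu x) = c * normc (H x).
  by rewrite Hconv !normcM normc_real ngamma mulr1 ger0_norm ?ltW.
have mconv : measurable_complex (convolution f mu : borel G -> R[i]).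
  rewrite (funext Hconv); apply: measurable_complexM => //.
  apply: measurable_complexM; first exact: measurable_complex_cst.
  exact: continuous_measurable_complex.
have Jconv : J_plus m p K P (convolution f mu).
  split.
    apply: (bounded_J hausdorffG haar_m p1 compactK mconv (M := c * M)) => x.
    by rewrite nconv ler_wpM2l// ltW.
  apply: aeW => x [PNx x0]; rewrite Hconv H0 ?mulr0// => Px.
  by apply: x0; apply: (ordered_group_anti ordP) => //; rewrite -sub0r.
pose fJ : J_plus m p K P := exist _ f (mem_set Jf).
(* Membership of the convolution in [J_plus] ensures that [insubd] returns it and not the default
   value 0. *)
have TfE : val (convolution_operator m K P p1 mu fJ) = convolution f mu.
  exact: (insubdK _ (mem_set Jconv)).
apply: (@le_trans _ _ (J_norm m p K (convolution f mu))); last first.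
  by rewrite -TfE; apply: ereal_sup_ubound; exists fJ; first exact: Jf_le1.
(* The case [B = 0] is separate because [J_norm_ge] asks for a positive limit. *)
have [B0|B_neq0] := eqVneq B 0.
  by rewrite B0; apply: le_trans (ereal_sup_ubound _); last (exists 0 => //);
    exact: poweR_ge0.
have B_gt0 : 0 < B by rewrite lt_neqAle eq_sym B_neq0 normc_ge0.
rewrite -(scale _ (ltW B_gt0)).
apply: (J_norm_ge m hausdorffG p1 compactK (w := w) mconv); first exact: mulr_gt0.
move=> y; under eq_fun do rewrite nconv.
apply: cvgMl_tmp; apply: (@complex_cvg_normc _ (H \o (fun n => w n - y))).
(* The shifted sequence [w n - y] is again cofinal: it exceeds [z] as soon as [w n] exceeds
   [y + z]. *)
apply: Hcvg => z; have := wP (y + z).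
by apply: filterS => n; rewrite opprD addrA.
Qed.
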